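(* For all $n\ge1$, $$\operatorname{tr}M^{(W(n))}(x)=\sum_{k=1}^{n+1}x^k\,k!\left(S(n+2,k+1)-S(n+1,k+1)\right),$$ where $S(\cdot,\cdot)$ denotes Stirling numbers of the second kind.
   Context: A 4-tuple $(x,y,a,b)$ is an edge from peg $x$ at height $a$ to peg $y$ at height $b$ (height 1 = bottom). $W(n)$ is the set (a web world) of web diagrams on $n+2$ pegs $D=\{(i,i+1,x_i,y_{i+1}):1\le i\le n+1\}$ with $x_1=y_{n+2}=1$ and $\{x_i,y_i\}=\{1,2\}$ for $2\le i\le n+1$. Reconstruction: $D\oplus D'=D\cup\{(x',y',a'+p_{x'}(D),b'+p_{y'}(D)):(x',y',a',b')\in D'\}$, $p_i(D)$ the number of endpoints of $D$ on peg $i$; $\mathrm{rel}(X)$ relabels heights of endpoints of edges of $X$ on each peg by $1,\dots,\ell_i$ preserving relative order; an $\ell$-colouring of $D$ is a surjection $c$ from its edges onto $\{1,\dots,\ell\}$, and $\mathcal{R}(D,c)=\mathrm{rel}(D_c(1))\oplus\cdots\oplus\mathrm{rel}(D_c(\ell))$ with $D_c(t)$ the edges of colour $t$. $f(D_1,D_2,\ell)$ is the number of $\ell$-colourings $c$ of $D_1$ with $\mathcal{R}(D_1,c)=D_2$; the web-colouring matrix has entries $M^{(W)}_{D_1,D_2}(x)=\sum_{\ell\ge1}x^\ell f(D_1,D_2,\ell)$. *)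

(* Defs.v *)
From HB Require Import structures.
From mathcomp Require Import all_boot all_order all_algebra.
From mathcomp Require Import finmap.

Set Implicit Arguments.
Unset Strict Implicit.
Unset Printing Implicit Defensive.

Import GRing.Theory.

Local Open Scope fset_scope.
Local Open Scope nat_scope.

(* (x, y, a, b): from peg x at height a to peg y at height b. *)
Definition edge := (nat * nat * nat * nat)%type.

Definition diagram := {fset edge}.

Definition map_heights (h : nat -> nat -> nat) (e : edge) : edge :=
  let: (x, y, a, b) := e in (x, y, h x a, h y b).

(* The endpoints of D on peg i, given by their heights: the endpoints of a web
   diagram on a given peg have distinct heights, and this remains true of its
   subsets. *)
Definition endpoints (D : diagram) (i : nat) : {fset nat} :=
  [fset e.1.2 | e in D & e.1.1.1 == i] `|` [fset e.2 | e in D & e.1.1.2 == i].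

Definition npeg (D : diagram) (i : nat) : nat := #|` endpoints D i|.

Definition oplus (D D' : diagram) : diagram :=
  D `|` [fset map_heights (fun i h => h + npeg D i) e | e in D'].

Definition rel_diagram (X : diagram) : diagram :=
  [fset map_heights (fun i h => #|` [fset k in endpoints X i | k <= h]|) e
  | e in X].

(* The colours 1, ..., l are represented by the elements 0, ..., l - 1 of
   'I_l. *)
Definition colouring (D : diagram) (l : nat) (c : {ffun D -> 'I_l}) : bool :=
  [forall t, exists e, c e == t].

Definition colour_class (D : diagram) (l : nat) (c : {ffun D -> 'I_l})
    (t : 'I_l) : diagram :=
  [fset val e | e : D & c e == t].

(* fset0 is a left unit of oplus. *)
Definition reconstruction (D : diagram) (l : nat) (c : {ffun D -> 'I_l}) :
    diagram :=
  foldl oplus fset0 [seq rel_diagram (colour_class c t) | t <- enum 'I_l].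

Definition ncolourings (D1 D2 : diagram) (l : nat) : nat :=
  #|[set c : {ffun D1 -> 'I_l} | colouring c & reconstruction c == D2]|.

Lemma ncolourings_eq0 (D1 D2 : diagram) (l : nat) :
  #|` D1| < l -> ncolourings D1 D2 l = 0.
Proof.
move=> ltDl; apply/eqP; rewrite cards_eq0; apply/eqP/setP=> c.
rewrite !inE; apply/negP=> /andP[/forallP surj_c _].
suff: l <= #|` D1| by rewrite leqNgt ltDl.
rewrite cardfE -{1}(card_ord l) -(cardsT 'I_l).
apply: leq_trans (leq_imset_card c _); apply/subset_leq_card/subsetP=> t _.
by have /existsP[e /eqP<-] := surj_c t; apply: imset_f.
Qed.

(* The series over l >= 1 is cut off at l = #|` D1|: by ncolourings_eq0 the
   remaining terms vanish. *)
Definition web_entry (D1 D2 : diagram) : {poly int} :=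
  (\sum_(1 <= l < #|` D1|.+1) (ncolourings D1 D2 l)%:R *: 'X^l)%R.

(* The rows and columns are indexed by the elements of W, in the order of the
   enumeration of the finite type W. *)
Definition web_matrix (W : {fset diagram}) : 'M[{poly int}]_#|{: W}| :=
  (\matrix_(i, j) web_entry (val (enum_val i)) (val (enum_val j)))%R.

Definition path_diagram (n : nat) (x y : nat -> nat) : diagram :=
  [fset (i, i.+1, x i, y i.+1) | i in iota 1 n.+1].

Definition path_heights (n : nat) (x y : nat -> nat) : bool :=
  [&& x 1 == 1, y n.+2 == 1
    & all (fun i => [fset x i; y i] == [fset 1; 2]) (iota 2 n)].

Definition heights (n : nat) (f : {ffun 'I_n.+3 -> 'I_3}) (i : nat) : nat :=
  f (inord i).

(* W(n); the functions x and y only matter on {1, ..., n + 2} and take values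
   in {1, 2} there, so they are drawn from a finite type of functions. *)
Definition web_world (n : nat) : {fset diagram} :=
  [fset path_diagram n (heights xy.1) (heights xy.2)
  | xy : {ffun 'I_n.+3 -> 'I_3} * {ffun 'I_n.+3 -> 'I_3}
  & path_heights n (heights xy.1) (heights xy.2)].

Lemma web_worldP (n : nat) (D : diagram) :
  reflect (exists x y : nat -> nat,
    [/\ x 1 = 1, y n.+2 = 1,
        forall i, 2 <= i <= n.+1 -> [fset x i; y i] = [fset 1; 2]
      & D = [fset (i, i.+1, x i, y i.+1) | i in iota 1 n.+1]])
    (D \in web_world n).
Proof.
apply: (iffP (imfsetP _ _ _ _)) => [[[x y] /= +] ->|[x [y [x1 yn xy ->]]]].
  rewrite !inE /= => /and3P[/eqP x1 /eqP yn /allP xy].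
  exists (heights x), (heights y); split=> // i i_in.
  by apply/eqP/xy; rewrite mem_iota add2n.
have xyle i : 2 <= i <= n.+1 -> (x i < 3) && (y i < 3).
  move=> /xy /fsetP E; move: (E (x i)) (E (y i)).
  rewrite !inE !eqxx orbT /=.
  by case: (x i) => [|[|[|?]]]; case: (y i) => [|[|[|?]]].
have xle i : 1 <= i <= n.+1 -> x i < 3.
  case: i => [|[|i]] // i_in; first by rewrite x1.
  by have /andP[] := xyle i.+2 i_in.
have yle i : 2 <= i <= n.+2 -> y i < 3.
  case/andP=> i2; rewrite leq_eqVlt => /predU1P[->|i_in]; first by rewrite yn.
  by have /andP[] := xyle i (introT andP (conj i2 i_in)).
pose fx := [ffun i : 'I_n.+3 => inord (x i) : 'I_3].
pose fy := [ffun i : 'I_n.+3 => inord (y i) : 'I_3].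
have fxE i : 1 <= i <= n.+1 -> heights fx i = x i.
  move=> i_in; have /andP[_ i_le] := i_in.
  by rewrite /heights ffunE (@inordK n.+2 i) ?inordK ?xle // ltnS ltnW.
have fyE i : 2 <= i <= n.+2 -> heights fy i = y i.
  move=> i_in; have /andP[_ i_le] := i_in.
  by rewrite /heights ffunE (@inordK n.+2 i) ?inordK ?yle.
clearbody fx fy; exists (fx, fy) => /=.
  rewrite !inE /= /path_heights fxE // fyE ?leqnn // x1 yn !eqxx /=.
  apply/allP=> i; rewrite mem_iota add2n => /andP[i2 i_le].
  rewrite fxE; last by rewrite (ltnW i2).
  rewrite fyE; last by rewrite i2 (ltnW i_le).
  by apply/eqP/xy; rewrite i2.
apply: eq_in_imfset => // i i_in; move: (i_in : i \in iota 1 n.+1).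
rewrite mem_iota add1n => /andP[i1 i_le].
by rewrite fxE ?fyE ?i1 // ltnS i1.
Qed.

Definition stirling2 (n k : nat) : nat :=
  #|[set P : {set {set 'I_n}} | partition P [set: 'I_n] & #|P| == k]|.

(* Main.v *)
(** Number the edges of a diagram of W(n) along the path. Reconstruction keeps
the order of the two edges at an interior peg if they have the same colour, and
otherwise puts the edge of smaller colour below. So D is fixed by a colouring c
iff at each interior peg the colours increase weakly from the lower to the upper
edge; given c, such a D can be chosen in 2 ways at each peg whose two edges have
the same colour, and in one way at every other peg. The coefficient of x^l in
the trace is thus T(n+1, l), the sum over the surjections from n + 1 edges to l
colours of 2 to the number of adjacent ties. Deleting the first edge gives
T(m+1, l) = (l+1) T(m, l) + l T(m, l-1), which l! (S(m+1, l+1) - S(m, l+1))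
satisfies as well. *)

Require Import Defs.
From mathcomp Require Import all_boot all_order all_algebra.
From mathcomp Require Import finmap zify.

Set Implicit Arguments.
Unset Strict Implicit.
Unset Printing Implicit Defensive.

(** * Stirling numbers of the second kind and their recurrence *)

Fixpoint stirling_rec (n k : nat) : nat :=
  match n, k with
  | 0, 0 => 1
  | 0, _.+1 => 0
  | _.+1, 0 => 0
  | n'.+1, k'.+1 => k'.+1 * stirling_rec n' k'.+1 + stirling_rec n' k'
  end.

(** Stated for an arbitrary finite set, so that induction can pass to the complement of a block. A
    sum of ones rather than a cardinal, so that big-operator reindexing applies directly. *)
Definition nparts (T : finType) (A : {set T}) (k : nat) : nat :=
  \sum_(P : {set {set T}} | partition P A && (#|P| == k)) 1.

(* A partition is determined by its block containing x and by the partition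
   that it induces on the complement B of this block. *)
Lemma nparts_block (T : finType) (E : {set T}) (x : T) (k : nat) : x \in E ->
  nparts E k.+1 = \sum_(B in powerset (E :\ x)) nparts B k.
Proof.
move=> xE; rewrite /nparts.
rewrite (partition_big (fun P : {set {set T}} => E :\: pblock P x)
  (fun B => B \in powerset (E :\ x))) /=; last first.
  move=> P /andP[/and3P[/eqP covP _ _] _]; rewrite powersetE subsetD1 subsetDl.
  by rewrite !inE mem_pblock covP xE.
apply: eq_bigr => B; rewrite powersetE subsetD1 => /andP[sBE xB].
have xC : x \in E :\: B by rewrite inE xB.
have C0 : E :\: B != set0 by apply/set0Pn; exists x.
have EB : (E :\: B) :|: B = E.
  by rewrite setUC setDE setUIr setUCr setIT; apply/setUidPr.
(* Adding and removing the block [E :\: B] are mutually inverse; it is never already in a partition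
   of [B], since it contains [x] and [B] does not. *)
rewrite (reindex_onto (fun Q => (E :\: B) |: Q) (fun P => P :\ (E :\: B))) /=.
  apply: eq_bigl => Q; apply/idP/idP.
    case/andP=> /andP[/andP[parQ /eqP cQ] _] /eqP KQ.
    have CQ : E :\: B \notin Q by rewrite -KQ !inE eqxx.
    have := partitionD1 parQ (setU11 _ _); rewrite KQ.
    rewrite setDDr setDv set0U (setIidPr sBE) => ->.
    by move: cQ; rewrite cardsU1 CQ add1n => -[->] /=.
  case/andP=> parQ /eqP cQ.
  have CQ : E :\: B \notin Q.
    apply/negP=> /(partitionS parQ)/subsetP/(_ _ xC); exact/negP.
  have dis : [disjoint E :\: B & B].
    by rewrite -setI_eq0 setDE -setIA [~: B :&: B]setIC setICr setI0.
  have parU := partitionU1 parQ C0 dis.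
  rewrite EB in parU; rewrite parU cardsU1 CQ cQ eqxx setU1K // eqxx andbT /=.
  rewrite (def_pblock (partition_trivIset parU) (setU11 _ _) xC).
  by rewrite setDDr setDv set0U (setIidPr sBE).
move=> P /andP[/andP[parP _] /eqP defB]; rewrite setD1K // -defB setDDr setDv.
have covP := cover_partition parP.
have Pb : pblock P x \in P by rewrite pblock_mem ?covP.
by rewrite set0U (setIidPr (partitionS parP Pb)).
Qed.

Lemma big_powersetU1 (T : finType) (A : {set T}) (x : T) (F : {set T} -> nat) :
  x \notin A ->
  \sum_(B in powerset (x |: A)) F B =
  \sum_(B in powerset A) F B + \sum_(B in powerset A) F (x |: B).
Proof.
move=> xA; rewrite (bigID (fun B : {set T} => x \in B)) /= addnC; congr (_ + _).
  by apply: eq_bigl => B; rewrite !powersetE -subsetD1 setU1K.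
rewrite (reindex_onto (fun B => x |: B) (fun B => B :\ x)) /=; last first.
  by move=> B /andP[_ xB]; rewrite setD1K.
apply: eq_bigl => B; rewrite !powersetE setU11 andbT.
apply/andP/idP=> [[sB /eqP KB]|sBA].
  by rewrite -KB -(setU1K xA); apply: setSD; exact: sB.
have xB : x \notin B by apply: contra xA => /(subsetP sBA).
by rewrite setUS ?setU1K.
Qed.

(** The counterpart for [stirling_rec] of [nparts_block]. Splitting the subsets on membership of a
    fixed [x] and expanding the recurrence on those that contain it, the induction hypothesis at [k]
    and at its predecessor closes the sum. *)
Lemma sum_stirling_rec_powerset (T : finType) (A : {set T}) (k : nat) :
  \sum_(B in powerset A) stirling_rec #|B| k = stirling_rec #|A|.+1 k.+1.
Proof.
have [m] := ubnP #|A|; elim: m => // m IHm in A k *.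
have [->|[x xA] ltAm] := set_0Vmem A.
  by rewrite powerset0 big_set1 cards0 => _; case: k => //= k; rewrite muln0.
have xA' : x \notin A :\ x by rewrite !inE eqxx.
have ltA' : #|A :\ x| < m by move: ltAm; rewrite (cardsD1 x) xA.
rewrite -(setD1K xA) big_powersetU1 // cardsU1 xA' add1n IHm //.
rewrite (eq_bigr (fun B : {set T} => stirling_rec #|B|.+1 k)); last first.
  move=> B; rewrite powersetE => /subsetP sB.
  by rewrite cardsU1 (contra (sB x) xA').
move: #|_| (IHm _ ^~ ltA') => a IH.
case: k => [|k]; first by rewrite big1 //= !mul1n !addn0.
rewrite big_split /= -big_distrr /= !IH /=; lia.
Qed.

(** By strong induction on the cardinal: both sides are sums of smaller instances over the subsets
    of [A :\ x]. *)
Lemma npartsE (T : finType) (A : {set T}) (k : nat) :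
  nparts A k = stirling_rec #|A| k.
Proof.
have [m] := ubnP #|A|; elim: m => // m IHm in A k *.
have [->|[x xA] ltAm] := set_0Vmem A.
  rewrite cards0 /nparts => _.
  rewrite (eq_bigl (fun P => (P == set0) && (k == 0))); last first.
    by move=> P; rewrite partition_set0; case: eqP => // ->; rewrite cards0 eq_sym.
  case: k => [|k]; last by rewrite big1 // => P; rewrite andbF.
  by rewrite (eq_bigl (pred1 set0)) ?big_pred1_eq // => P; rewrite andbT.
case: k => [|k].
  rewrite (cardsD1 x) xA /nparts big1 // => P /andP[parP].
  rewrite cards_eq0 => /eqP P0; have := cover_partition parP.
  by rewrite P0 /cover big_set0 => A0; rewrite -A0 inE in xA.
have lt_sub B : B \in powerset (A :\ x) -> #|B| < m.
  rewrite powersetE => /subset_leq_card leB.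
  by move: ltAm; rewrite (cardsD1 x) xA ltnS; apply: leq_ltn_trans.
rewrite (nparts_block k xA) (cardsD1 x) xA add1n -sum_stirling_rec_powerset.
by apply: eq_bigr => B /lt_sub/IHm->.
Qed.

Lemma stirling2E (n k : nat) : stirling2 n k = stirling_rec n k.
Proof.
rewrite /stirling2 -sum1_card -[n in RHS]card_ord -cardsT -npartsE /nparts.
by apply: eq_bigl => P; rewrite !inE.
Qed.

(** * Surjections weighted by adjacent ties *)

(** The factor [(a == b).+1] is 2 at a tie and 1 otherwise, so this is 2 to the number of adjacent
    ties. *)
Fixpoint tie_weight (C : eqType) (s : seq C) : nat :=
  if s is a :: s' then
    (if s' is b :: _ then (a == b).+1 else 1) * tie_weight s'
  else 1.

(** This is T(m, [#|A|]). The set of colours used is a parameter because deleting the first entry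
    may remove a colour from it. *)
Definition tie_sum (C : finType) (m : nat) (A : {set C}) : nat :=
  \sum_(s : m.-tuple C | [set a in s] == A) tie_weight s.

Lemma big_tuple_cons (C : finType) (m : nat) (P : pred (seq C))
    (F : seq C -> nat) :
  \sum_(s : m.+1.-tuple C | P s) F s =
  \sum_(a : C) \sum_(s : m.-tuple C | P (a :: s)) F (a :: s).
Proof.
rewrite pair_big_dep /=.
rewrite (reindex (fun p : C * m.-tuple C => [tuple of p.1 :: p.2])) //=.
exists (fun s => (thead s, [tuple of behead s])) => [[a s] _|s _] /=.
  by congr (_, _); apply: val_inj.
by rewrite [in RHS](tuple_eta s).
Qed.

Lemma sum_indicator (C : finType) (A : {set C}) (b : C) :
  \sum_(a in A) (a == b : nat) = (b \in A).
Proof.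
rewrite -big_mkcondr /=; case: (boolP (b \in A)) => bA.
  rewrite (eq_bigl (pred1 b)) ?big_pred1_eq // => a /=.
  by case: eqP => [->|]; rewrite ?bA ?andbF.
rewrite big1 // => a /andP[aA /eqP ab].
by rewrite -ab aA in bA.
Qed.

(** Once its first entry [a] is deleted, a tuple uses either [A] or [A :\ a]. In the first case the
    lost factor is 1, or 2 if [a] is the next entry; summed over [a] in [A] this gives [#|A|.+1]. In
    the second case [a] does not recur, so the factor is 1. The length [m.+2] makes the tail
    nonempty. *)
Lemma tie_sumS (C : finType) (m : nat) (A : {set C}) :
  tie_sum m.+2 A =
  #|A|.+1 * tie_sum m.+1 A + \sum_(a in A) tie_sum m.+1 (A :\ a).
Proof.
rewrite /tie_sum.
rewrite (@big_tuple_cons C m.+1 (fun s => [set a in s] == A)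
  (fun s => tie_weight s)).
have setcons a (s : m.+1.-tuple C) : ([set z in a :: s] == A) =
    (a \in A) && (([set z in s] == A) || ([set z in s] == A :\ a)).
  apply/eqP/andP=> [<-|[aA /orP[]/eqP E]]; last first.
  - by apply/setP=> z; have /setP/(_ z) := E; rewrite !inE => ->; case: eqP => // ->.
  - by apply/setP=> z; have /setP/(_ z) := E; rewrite !inE => ->; case: eqP => // ->.
  rewrite !inE eqxx; split=> //; case: (boolP (a \in s)) => as_; apply/orP.
    by left; apply/eqP/setP=> z; rewrite !inE; case: eqP => // ->.
  by right; apply/eqP/setP=> z; rewrite !inE; case: eqP => //= ->; apply/negbTE.
have splitA a : a \in A ->
  \sum_(s : m.+1.-tuple C | [set z in a :: s] == A) tie_weight (a :: s) =
  \sum_(s : m.+1.-tuple C | [set z in s] == A) (a == thead s).+1 * tie_weight s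
  + \sum_(s : m.+1.-tuple C | [set z in s] == A :\ a) tie_weight s.
  move=> aA.
  rewrite (bigID (fun s : m.+1.-tuple C => [set z in s] == A)) /=.
  congr (_ + _).
    apply: eq_big => [s|s _]; first by rewrite setcons aA; case: eqP; rewrite ?andbF.
    by rewrite [in LHS](tuple_eta s) [in RHS](tuple_eta s) theadE.
  apply: eq_big => [s|s].
    rewrite setcons aA /=; case: eqP => [->|] //=; last by rewrite andbT.
    apply/esym/negbTE/eqP=> /setP/(_ a); rewrite !inE aA eqxx //.
  rewrite setcons aA /= => /andP[/orP[->//|/eqP sA _]].
  case E : (tval s) (size_tuple s) => [|b s'] //= _; case: eqP => [ab|_]; last by rewrite mul1n.
  by have /setP/(_ a) := sA; rewrite !inE eqxx memtE E ab mem_head.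
rewrite (bigID (mem A)) /= [X in _ + X]big1 ?addn0; last first.
  move=> a /negbTE aA; apply: big1 => s /eqP sA.
  by have /setP/(_ a) := sA; rewrite !inE eqxx aA.
rewrite (eq_bigr _ splitA) big_split /=; congr (_ + _).
rewrite exchange_big /= big_distrr /=; apply: eq_bigr => s /eqP sA.
rewrite -big_distrl /=; congr (_ * _).
rewrite (eq_bigr (fun a => (a == thead s) + 1)) => [|a _]; last by rewrite addn1.
rewrite big_split /= sum_indicator sum1_card -sA inE.
by rewrite [X in _ \in X](tuple_eta s) mem_head add1n.
Qed.

(** The closed form of T with the subtracted Stirling number moved to the left, which avoids
    truncated subtraction. *)
Lemma tie_sumE (C : finType) (m : nat) (A : {set C}) :
  tie_sum m.+1 A + (#|A|)`! * stirling_rec m.+1 (#|A|).+1 =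
  (#|A|)`! * stirling_rec m.+2 (#|A|).+1.
Proof.
elim: m => [|m IHm] in A *.
  rewrite /tie_sum (@big_tuple_cons C 0 (fun s => [set a in s] == A)
    (fun s => tie_weight s)).
  have {}eq1 a : \sum_(s : 0.-tuple C | [set z in a :: s] == A) tie_weight (a :: s)
      = ([set a] == A).
    have defa (s : 0.-tuple C) : [set z in a :: s] = [set a].
      by apply/setP=> z; rewrite !inE (tuple0 s) in_nil orbF.
    under eq_bigl do rewrite defa.
    rewrite big_mkcond (eq_bigr (fun=> nat_of_bool ([set a] == A))) /=.
      by rewrite sum_nat_const card_tuple expn0 mul1n.
    by move=> s _; rewrite (tuple0 s); case: ifP.
  under eq_bigr do rewrite eq1.
  have -> : \sum_(a : C) ([set a] == A : nat) = (#|A| == 1).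
    case: (boolP (#|A| == 1)) => [/cards1P[b ->]|cA].
      rewrite (eq_bigr (fun a => nat_of_bool (a == b))).
        have := sum_indicator [set: C] b; rewrite inE => <-.
        by apply: eq_bigl => a; rewrite inE.
      by move=> a _; rewrite (inj_eq set1_inj).
    by rewrite big1 // => a _; case: eqP => // Aa; rewrite -Aa cards1 in cA.
  case: #|A| => [|[|a]] //=; rewrite ?muln0 //.
rewrite tie_sumS.
set l := #|A|.
(* The induction hypothesis for each [A :\ a], summed over [a]; the [l] equal terms turn [(l-1)!]
   into [l!]. For [l = 0] both sides vanish. *)
have sumE : \sum_(a in A) tie_sum m.+1 (A :\ a) + l`! * stirling_rec m.+1 l
    = l`! * stirling_rec m.+2 l.
  have cD a : a \in A -> #|A :\ a| = l.-1 by move=> aA; rewrite /l (cardsD1 a A) aA.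
  case El : l cD => [|l'] /= cD.
    by move/cards0_eq: El => ->; rewrite big_set0.
  have eqc a : a \in A -> tie_sum m.+1 (A :\ a) =
      l'`! * stirling_rec m.+2 l'.+1 - l'`! * stirling_rec m.+1 l'.+1.
    by move=> aA; rewrite -(cD a aA) -IHm addnK.
  rewrite (eq_bigr _ eqc) sum_nat_const -/l El factS -!mulnA -mulnDr subnK //.
  have /card_gt0P[a aA] : 0 < #|A| by rewrite -/l El.
  by have := IHm (A :\ a); rewrite (cD a aA) /= => <-; rewrite leq_addl.
have := IHm A; rewrite -/l.
have R j : stirling_rec j.+1 l.+1 = l.+1 * stirling_rec j l.+1 + stirling_rec j l.
  by [].
(* After expanding both Stirling numbers, the goal is [l.+1] times [E] plus [sumE]. *)
rewrite (R m.+2) => E; rewrite [X in _ + l`! * X = _]R; nia.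
Qed.

(** * Endpoint heights in a reconstruction *)

Local Open Scope fset_scope.
Local Open Scope nat_scope.

Lemma endpointsP (D : diagram) (i h : nat) :
  reflect (exists2 e, e \in D &
             (e.1.1.1 = i /\ e.1.2 = h) \/ (e.1.1.2 = i /\ e.2 = h))
          (h \in endpoints D i).
Proof.
rewrite /endpoints in_fsetU; apply: (iffP orP) => [[]/imfsetP[e /= /andP[eD /eqP ei] ->]|[e eD []]].
- by exists e => //; left.
- by exists e => //; right.
- by case=> ei <-; left; apply/imfsetP; exists e; rewrite //= inE eD; apply/eqP.
- by case=> ei <-; right; apply/imfsetP; exists e; rewrite //= inE eD; apply/eqP.
Qed.

Lemma endpointsU (D D' : diagram) (i : nat) :
  endpoints (D `|` D') i = endpoints D i `|` endpoints D' i.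
Proof.
apply/fsetP=> h; rewrite in_fsetU; apply/endpointsP/orP.
  by case=> e; rewrite in_fsetU => /orP[] eD He; [left|right];
    apply/endpointsP; exists e.
by case=> /endpointsP[e eD He]; exists e; rewrite // in_fsetU eD ?orbT.
Qed.

Lemma endpoints_map (f : nat -> nat -> nat) (D : diagram) (i : nat) :
  endpoints [fset map_heights f e | e in D] i =
  [fset f i h | h in endpoints D i].
Proof.
apply/fsetP=> h; apply/endpointsP/imfsetP=> /=.
  case=> e' /imfsetP[[[[u v] a] b] /= eD ->] /= [] [ui <-].
    by exists a; rewrite ?ui //; apply/endpointsP; exists (u, v, a, b) => //; left.
  by exists b; rewrite ?ui //; apply/endpointsP; exists (u, v, a, b) => //; right.
case=> k /endpointsP[[[[u v] a] b] /= eD He] ->.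
exists (map_heights f (u, v, a, b)); first exact: in_imfset.
by case: He => /= -[-> ->]; [left|right].
Qed.

Definition height_rank (E : {fset nat}) (h : nat) : nat :=
  #|` [fset k in E | k <= h]|.

Lemma mem_height_rank_image (E : {fset nat}) (h : nat) :
  (h \in [fset height_rank E k | k in E]) = (0 < h <= #|` E|).
Proof.
have rank_mono u v : u \in E -> u < v -> v \in E ->
    height_rank E u < height_rank E v.
  move=> uE ltuv vE; apply: fproper_ltn_card; 
  rewrite fproperEneq; apply/andP; split; last first.
    apply/fsubsetP=> k; rewrite !inE /= => /andP[-> /leq_trans->] //.
    exact: ltnW.
  apply/eqP=> /fsetP/(_ v); rewrite !inE /= vE leqnn /=.
  by rewrite leqNgt ltuv.
have -> : [fset height_rank E k | k in E] = [fset k in iota 1 #|` E|].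
  apply/eqP; rewrite eqEfcard; apply/andP; split.
    apply/fsubsetP=> _ /imfsetP[k /= kE ->].
    rewrite inE /= mem_iota add1n ltnS; apply/andP; split.
      rewrite cardfs_gt0; apply/fset0Pn; exists k.
      by rewrite !inE /= kE leqnn.
    by apply: fsubset_leq_card; apply/fsubsetP=> j; rewrite !inE => /andP[].
  rewrite [X in _ <= X]card_in_imfset /=; last first.
    move=> u v uE vE; case: (ltngtP u v) => // ltuv E_uv.
      by have := rank_mono _ _ uE ltuv vE; rewrite E_uv ltnn.
    by have := rank_mono _ _ vE ltuv uE; rewrite E_uv ltnn.
  apply: leq_trans (leq_imfset_card _ _ _) _.
  by rewrite /= undup_id ?iota_uniq // size_iota.
by rewrite inE /= mem_iota add1n ltnS.
Qed.

(** The invariant that makes [oplus] a genuine stacking: with no gaps on any peg, the shifted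
    endpoints start just above the old ones, and [npeg] is additive. *)
Definition packed (D : diagram) : Prop :=
  forall i h, (h \in endpoints D i) = (0 < h <= npeg D i).

Lemma card_fset_interval (E : {fset nat}) (m : nat) :
  (forall h, (h \in E) = (0 < h <= m)) -> #|` E| = m.
Proof.
move=> EP; have -> : E = [fset k in iota 1 m].
  by apply/fsetP=> h; rewrite EP inE /= mem_iota add1n ltnS.
by rewrite card_imfset //= undup_id ?iota_uniq // size_iota.
Qed.

Lemma npeg_rel_diagram (X : diagram) (i : nat) :
  npeg (rel_diagram X) i = npeg X i.
Proof.
apply: card_fset_interval => h.
by rewrite /rel_diagram endpoints_map (mem_height_rank_image (endpoints X i)).
Qed.

Lemma packed_rel_diagram (X : diagram) : packed (rel_diagram X).
Proof.
move=> i h; rewrite npeg_rel_diagram.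
by rewrite /rel_diagram endpoints_map (mem_height_rank_image (endpoints X i)).
Qed.

Lemma mem_endpoints_oplus (D D' : diagram) (i h : nat) :
  packed D -> packed D' ->
  (h \in endpoints (oplus D D') i) = (0 < h <= npeg D i + npeg D' i).
Proof.
move=> pD pD'; rewrite /oplus endpointsU endpoints_map in_fsetU pD.
apply/orP/idP.
  by case=> [|/imfsetP[k /=]]; [|rewrite pD' => + ->]; lia.
move=> h_in; case: (leqP h (npeg D i)) => hD; [left; lia|right].
by apply/imfsetP; exists (h - npeg D i); rewrite /= ?pD'; lia.
Qed.

Lemma npeg_oplus (D D' : diagram) (i : nat) : packed D -> packed D' ->
  npeg (oplus D D') i = npeg D i + npeg D' i.
Proof.
by move=> pD pD'; apply: card_fset_interval => h; rewrite mem_endpoints_oplus.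
Qed.

Lemma packed_oplus (D D' : diagram) :
  packed D -> packed D' -> packed (oplus D D').
Proof. by move=> pD pD' i h; rewrite mem_endpoints_oplus // npeg_oplus. Qed.

(** The final height of an endpoint: all endpoints of smaller colour on its peg lie below it, and
    within its own colour it keeps its rank. *)
Definition stacked_height (l : nat) (X : 'I_l -> diagram) (ts : seq 'I_l)
    (t : 'I_l) (i h : nat) : nat :=
  \sum_(s <- ts | s < t) npeg (X s) i + height_rank (endpoints (X t) i) h.

(** Induction on the last class stacked. The first two conclusions are carried along because they
    determine the shift applied to that class; the increasing order makes the classes already
    stacked exactly those of smaller colour in the list. *)
Lemma foldl_oplus_rel (l : nat) (X : 'I_l -> diagram) (ts : seq 'I_l)
    (R := foldl oplus fset0 [seq rel_diagram (X t) | t <- ts]) :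
  pairwise (fun s t : 'I_l => s < t) ts ->
  [/\ packed R, forall i, npeg R i = \sum_(s <- ts) npeg (X s) i
    & forall e', e' \in R <-> exists2 t, t \in ts & exists2 e, e \in X t &
                   e' = map_heights (stacked_height X ts t) e].
Proof.
rewrite {}/R; elim/last_ind: ts => [_|ts u IH].
  have e0 i : endpoints fset0 i = fset0.
    by apply/fsetP=> h; rewrite inE; apply/endpointsP=> -[e]; rewrite inE.
  split=> [i h|i|e']; rewrite /= ?/npeg ?e0 ?cardfs0 ?big_nil ?inE //.
    by case: h.
  by split=> // -[].
rewrite pairwise_rcons map_rcons foldl_rcons => /andP[/allP lt_u].
case/IH; set R := foldl _ _ _ => pR nR memR.
have pX := packed_rel_diagram (X u).
split=> [|i|e']; first exact: packed_oplus.
  by rewrite npeg_oplus // nR npeg_rel_diagram -cats1 big_cat big_seq1.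
(* Edges already placed do not move, because [u] exceeds their colours. *)
have shE t : t \in ts ->
    stacked_height X (rcons ts u) t =2 stacked_height X ts t.
  move=> t_ts i h; rewrite /stacked_height -cats1 big_cat /= big_cons big_nil.
  by have := lt_u t t_ts => /ltnW; rewrite leqNgt => /negbTE->; rewrite addn0.
have mapE f g e : f =2 g -> map_heights f e = map_heights g e.
  by move=> fg; case: e => [[[? ?] ?] ?] /=; rewrite !fg.
(* Every colour in [ts] is below [u], so the sum over smaller colours is the whole of [npeg R]. *)
have shu : stacked_height X (rcons ts u) u =2
    fun i h => height_rank (endpoints (X u) i) h + npeg R i.
  move=> i h; rewrite /stacked_height -cats1 big_cat /= big_cons big_nil ltnn.
  rewrite addn0 addnC nR; congr (_ + _); rewrite [LHS]big_seq_cond [RHS]big_seq.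
  by apply: eq_bigl => s; apply: andb_idr => /lt_u.
rewrite /oplus in_fsetU; split=> [/orP[/memR[t t_ts [e eX ->]]|]|].
- exists t; first by rewrite mem_rcons inE t_ts orbT.
  by exists e => //; apply: mapE => i h; rewrite shE.
- case/imfsetP=> _ /= /imfsetP[e /= eX ->] ->.
  exists u; first by rewrite mem_rcons mem_head.
  exists e => //; rewrite (mapE _ _ _ shu).
  by case: e {eX} => [[[? ?] ?] ?].
case=> t; rewrite mem_rcons inE => /predU1P[->|t_ts] [e eX ->]; apply/orP.
  right; apply/imfsetP; exists (map_heights (fun i => height_rank (endpoints (X u) i)) e).
    by apply/imfsetP; exists e.
  by rewrite (mapE _ _ _ shu); case: e {eX} => [[[? ?] ?] ?].
left; apply/memR; exists t => //; exists e => //.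
by apply: mapE => i h; rewrite shE.
Qed.

Lemma mem_reconstruction (D : diagram) (l : nat) (c : {ffun D -> 'I_l})
    (e' : edge) :
  reflect (exists e : D, e' =
    map_heights (stacked_height (colour_class c) (enum 'I_l) (c e)) (val e))
    (e' \in reconstruction c).
Proof.
have lt_enum : pairwise (fun s t : 'I_l => s < t) (enum 'I_l).
  rewrite -(@pairwise_map _ _ val ltn) val_enum_ord.
  by rewrite -sorted_pairwise ?iota_ltn_sorted //; exact: ltn_trans.
have [_ _ memR] := foldl_oplus_rel (colour_class c) lt_enum.
apply: (iffP idP) => [/memR[t _ [e]]|[e ->]].
  by move=> /imfsetP[d /= /eqP <- ->] ->; exists d.
apply/memR; exists (c e); first by rewrite mem_enum.
by exists (val e) => //; apply: in_imfset; rewrite /= inE.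
Qed.

(** * Colour classes and reconstruction of path diagrams *)

(** Meant for a peg of a path diagram: at most two endpoints, whose presence is recorded by [b1] and
    [b2]. *)
Lemma card_fset_pair (E : {fset nat}) (p : pred nat) (b1 b2 : bool)
    (u v : nat) :
  (forall h, (h \in E) = (b1 && (h == u)) || (b2 && (h == v))) ->
  (b1 -> b2 -> u != v) ->
  #|` [fset k in E | p k]| = (b1 && p u) + (b2 && p v).
Proof.
move=> EP uv.
have -> : [fset k in E | p k] = (if b1 && p u then [fset u] else fset0) `|`
    (if b2 && p v then [fset v] else fset0).
  apply/fsetP=> h; rewrite in_fsetU !inE /= EP andb_orl; congr (_ || _).
    case: eqP => [->|hu]; rewrite ?andbF ?andbT; first by case: ifP; rewrite ?inE ?eqxx.
    by case: ifP; rewrite !inE // => _; apply/esym/eqP.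
  case: eqP => [->|hu]; rewrite ?andbF ?andbT; first by case: ifP; rewrite ?inE ?eqxx.
  by case: ifP; rewrite !inE // => _; apply/esym/eqP.
case: b1 b2 uv {EP} => [] [] uv /=; case: (p u); case: (p v);
  rewrite ?fsetU0 ?fset0U ?cardfs0 ?cardfs1 ?cardfs2 ?uv //.
Qed.

Lemma sum_ord_eq (l : nat) (b : bool) (a : nat) (t : 'I_l) :
  \sum_(s <- enum 'I_l | s < t) (b && (a == s) : nat) = b && (a < t).
Proof.
case: b; last by rewrite big1.
rewrite big_enum_cond /=; case: ltnP => [lt_at|le_ta]; last first.
  rewrite big1 // => s lt_st; case: eqP => // as_.
  by move: le_ta; rewrite as_ leqNgt lt_st.
pose s0 : 'I_l := Ordinal (ltn_trans lt_at (ltn_ord t)).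
rewrite (bigD1 s0) //= eqxx big1 // => s /andP[_ /eqP ns].
by case: eqP => // as_; case: ns; apply: val_inj.
Qed.

Section PathColouring.

Variables (n l : nat) (x y : nat -> nat).
Local Notation D := (path_diagram n x y).
Local Notation ed := (fun i => (i, i.+1, x i, y i.+1) : edge).
Hypothesis xy : forall i, 1 < i < n.+2 -> x i != y i.

Lemma mem_path_diagram (e : edge) :
  reflect (exists2 i, 0 < i < n.+2 & e = ed i) (e \in D).
Proof.
have iotaE i : (i \in iota 1 n.+1) = (0 < i < n.+2) by rewrite mem_iota add1n.
apply: (iffP (imfsetP _ _ _ _)) => -[i i_in ->]; exists i => //.
  by rewrite -iotaE.
by move: i_in; rewrite -iotaE.
Qed.

(** [g] gives the colour of the edge leaving peg [i] as a plain number, free of the membership proof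
    that [c] requires. *)
Variables (c : {ffun D -> 'I_l}) (g : nat -> nat).
Hypothesis cg : forall (i : nat) (eD : ed i \in D), c [` eD] = g i :> nat.

Lemma mem_path_colour_class (t : 'I_l) (e : edge) :
  reflect (exists2 i, (0 < i < n.+2) && (g i == t) & e = ed i)
          (e \in colour_class c t).
Proof.
apply: (iffP (imfsetP _ _ _ _)) => [[[d dD] /= /eqP cd ->]|[i /andP[i_in /eqP gi] ->]].
  have /mem_path_diagram[i i_in di] := dD; exists i => //; rewrite i_in /=.
  by move: dD cd; rewrite di => dD <-; rewrite cg.
have eD : ed i \in D by apply/mem_path_diagram; exists i.
by exists [` eD] => //; rewrite /= inE; apply/eqP/val_inj; rewrite /= cg.
Qed.

(** Edge [i] leaves peg [i] at height [x i], for pegs 1 to n + 1; edge [i.-1] arrives there at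
    height [y i], for pegs 2 to n + 2. *)
Lemma mem_endpoints_path_class (t : 'I_l) (i h : nat) :
  (h \in endpoints (colour_class c t) i) =
  ((0 < i < n.+2) && (g i == t)) && (h == x i) ||
  ((1 < i < n.+3) && (g i.-1 == t)) && (h == y i).
Proof.
apply/endpointsP/orP.
  case=> e /mem_path_colour_class[j /andP[j_in gj] ->] /= [] [<- <-].
    by left; rewrite j_in gj eqxx.
  by right; rewrite gj eqxx !andbT !ltnS.
case=> /andP[/andP[i_in gi] /eqP->].
  by exists (ed i); [apply/mem_path_colour_class; exists i; rewrite ?i_in|left].
case: i i_in gi => // i i_in gi; exists (ed i); last by right.
by apply/mem_path_colour_class; exists i; rewrite //= gi andbT; lia.
Qed.

Lemma count_endpoints_path_class (t : 'I_l) (i : nat) (p : pred nat) :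
  #|` [fset k in endpoints (colour_class c t) i | p k]| =
  [&& 0 < i < n.+2, g i == t & p (x i)] +
  [&& 1 < i < n.+3, g i.-1 == t & p (y i)].
Proof.
rewrite (card_fset_pair p (mem_endpoints_path_class t i)).
  by rewrite -!andbA.
by case/andP=> i1 _ /andP[i2 _]; apply: xy; lia.
Qed.

Lemma path_stacked_height (t : 'I_l) (i h : nat) :
  stacked_height (colour_class c) (enum 'I_l) t i h =
  ((0 < i < n.+2) && (g i < t)) + ((1 < i < n.+3) && (g i.-1 < t)) +
  ([&& 0 < i < n.+2, g i == t & x i <= h] +
   [&& 1 < i < n.+3, g i.-1 == t & y i <= h]).
Proof.
rewrite /stacked_height /height_rank count_endpoints_path_class; congr (_ + _).
rewrite -!sum_ord_eq -big_split; apply: eq_bigr => s _ /=.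
have := count_endpoints_path_class s i predT; rewrite !andbT => <-.
by congr #|` _|; apply/fsetP=> k; rewrite !inE andbT.
Qed.

(* Edges of a path diagram are determined by their pegs, which reconstruction
   preserves. *)
Lemma path_reconstruction_eq :
  reconstruction c = D <->
  (forall i (eD : ed i \in D),
     map_heights (stacked_height (colour_class c) (enum 'I_l) (c [` eD])) (ed i)
     = ed i).
Proof.
split=> [RD i eD|fixD].
  set e' := map_heights _ _.
  have : e' \in D by rewrite -RD; apply/mem_reconstruction; exists [` eD].
  by case/mem_path_diagram=> j _; rewrite /e' /= => -[ij]; rewrite -ij => _ -> ->.
apply/fsetP=> e; apply/mem_reconstruction/idP => [[[d dD] ->] /=|eD].
  by have /mem_path_diagram[i _ di] := dD; move: dD; rewrite di => dD; rewrite fixD.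
exists [` eD] => /=; have /mem_path_diagram[i _ di] := eD.
by move: eD; rewrite di => eD; rewrite fixD.
Qed.

End PathColouring.

(** * Diagrams encoded by bits, and the colourings that fix them *)

(* b j tells whether, on peg j + 2, the edge to the next peg is the upper one. *)
Definition bit_x (n : nat) (b : nat -> bool) (i : nat) : nat :=
  if 1 < i < n.+2 then (b i.-2).+1 else 1.

(** Complementary to [bit_x] on interior pegs; the default 1 supplies the conditions at the two end
    pegs. *)
Definition bit_y (n : nat) (b : nat -> bool) (i : nat) : nat :=
  if 1 < i < n.+2 then (~~ b i.-2).+1 else 1.

Definition bit_diagram (n : nat) (b : nat -> bool) : diagram :=
  path_diagram n (bit_x n b) (bit_y n b).

Lemma bit_xy n b i : 1 < i < n.+2 -> bit_x n b i != bit_y n b i.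
Proof. by rewrite /bit_x /bit_y => ->; case: (b _). Qed.

(** On peg j + 2, edge j + 1 arrives and edge j + 2 leaves. Distinct colours force the order of
    these two endpoints, hence the bit; equal colours preserve their order, and the equation holds
    for either bit. *)
Lemma bit_reconstruction (n l : nat) (b : nat -> bool)
    (c : {ffun bit_diagram n b -> 'I_l}) (g : nat -> nat) :
  (forall i (eD : (i, i.+1, bit_x n b i, bit_y n b i.+1) \in bit_diagram n b),
     c [` eD] = g i :> nat) ->
  reconstruction c = bit_diagram n b <->
  (forall j, j < n ->
     b j = (g j.+1 < g j.+2) || ((g j.+1 == g j.+2) && b j)).
Proof.
move=> cg; split.
  move/(path_reconstruction_eq c) => fixD j ltjn.
  have eD : (j.+2, j.+3, bit_x n b j.+2, bit_y n b j.+3) \in bit_diagram n b.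
    by apply/mem_path_diagram; exists j.+2.
  have [+ _] := fixD _ eD.
  rewrite (path_stacked_height (@bit_xy n b) cg) cg /bit_x /bit_y /= !ltnS ltjn.
  rewrite (ltnW ltjn) ltnn eqxx.
  by case: (b j); case: (ltngtP (g j.+1) (g j.+2)).
move=> fixD; apply/path_reconstruction_eq => i eD.
have /mem_path_diagram[k k_in [ik _ _ _]] := eD; rewrite -ik in k_in.
rewrite /= !(path_stacked_height (@bit_xy n b) cg) cg /= !ltnn eqxx !leqnn.
have i_in' : 1 < i.+1 < n.+3 by lia.
clear ik; rewrite i_in' /bit_x /bit_y /=.
congr (_, _, _, _).
  case: i k_in {eD i_in'} => [|[|i]] //= k_in.
  rewrite !ltnS in k_in *; have := fixD i k_in; rewrite k_in (ltnW k_in).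
  by case: (b i); case: (ltngtP (g i.+1) (g i.+2)).
case: i k_in {eD i_in'} => [|i] //= k_in; rewrite !ltnS in k_in *.
(* In the remaining case the edge ends on the last peg, where its endpoint is alone. *)
case: (ltnP i n) => lt_in //=.
have := fixD i lt_in.
by case: (b i); case: (ltngtP (g i.+1) (g i.+2)).
Qed.

(* Colours s weakly increase from edge j to edge j + 1 if the latter is the
   upper one on their common peg, and weakly decrease otherwise. *)
Definition compatible (n : nat) (b : nat -> bool) (s : seq nat) : bool :=
  [forall j : 'I_n, b j == (nth 0 s j < nth 0 s j.+1) ||
                           ((nth 0 s j == nth 0 s j.+1) && b j)].

Lemma card_bit_diagram (n : nat) (b : nat -> bool) :
  #|` bit_diagram n b| = n.+1.
Proof.
rewrite card_imfset => [|i j [] //].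
by rewrite -[LHS]/(size (undup (iota 1 n.+1))) undup_id ?iota_uniq ?size_iota.
Qed.

(** Listing the colours along the path turns colourings into tuples; entry [k] is the colour of edge
    [k.+1]. *)
Lemma ncolourings_bit_diagram (n l : nat) (b : nat -> bool) :
  ncolourings (bit_diagram n b) (bit_diagram n b) l =
  #|[set s : n.+1.-tuple 'I_l |
       ([set a in s] == [set: 'I_l]) && compatible n b (map val s)]|.
Proof.
set D := bit_diagram n b.
have memD (k : 'I_n.+1) :
    (k.+1, k.+2, bit_x n b k.+1, bit_y n b k.+2) \in D.
  by apply/mem_path_diagram; exists k.+1; rewrite //= ltnS ltn_ord.
pose tup (c : {ffun D -> 'I_l}) := [tuple c [` memD k] | k < n.+1].
have memDE (d : D) : exists k, d = [` memD k].
  case: d => d dD; have /mem_path_diagram[[|i] // i_in di] := dD.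
  by exists (Ordinal (i_in : i < n.+1)); apply: val_inj.
have tup_inj : injective tup.
  move=> c c' eq_t; apply/ffunP=> d; have [k ->] := memDE d.
  by have := congr1 (fun t => tnth t k) eq_t; rewrite !tnth_mktuple.
(* Both types have l to the power n + 1 elements, so injectivity suffices. *)
have tup_bij : bijective tup.
  apply: (inj_card_bij tup_inj).
  by rewrite card_ffun card_tuple card_ord -cardfE card_bit_diagram.
rewrite -(on_card_preimset (onW_bij _ tup_bij)); apply: eq_card => c.
rewrite !inE; congr (_ && _).
  apply/forallP/eqP=> [surj|/setP surj t].
    apply/setP=> t; rewrite !inE; have /existsP[d /eqP<-] := surj t.
    have [k ->] := memDE d; apply/tnthP; exists k.
    by rewrite tnth_mktuple.
  have := surj t; rewrite !inE => /tnthP[k ->].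
  by apply/existsP; exists [` memD k]; rewrite tnth_mktuple.
set s := map val (tup c).
have cg i (eD : (i, i.+1, bit_x n b i, bit_y n b i.+1) \in D) :
    c [` eD] = nth 0 s i.-1 :> nat.
  have /mem_path_diagram[[|j] // lt_jn [ij _ _]] := eD.
  move: eD; rewrite ij => eD; rewrite /s /=.
  pose k := Ordinal (lt_jn : j < n.+1).
  rewrite (nth_map (c [` eD])) ?size_tuple ?card_ord //.
  rewrite -(tnth_nth _ (tup c) k) tnth_mktuple.
  by have -> : [` memD k] = [` eD] by apply: val_inj.
rewrite /compatible; apply/eqP/forallP=> [/(bit_reconstruction cg) Rc j|ok].
  by apply/eqP; exact: Rc.
by apply/(bit_reconstruction cg) => j lt_jn; have /eqP := ok (Ordinal lt_jn).
Qed.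

(** * Enumeration of the web world and the trace *)

Definition bits (n : nat) (b : {ffun 'I_n -> bool}) (j : nat) : bool :=
  oapp b false (insub j).

Lemma bitsE (n : nat) (b : {ffun 'I_n -> bool}) (j : 'I_n) : bits b j = b j.
Proof. by rewrite /bits valK. Qed.

Lemma bit_diagram_inj (n : nat) :
  injective (fun b : {ffun 'I_n -> bool} => bit_diagram n (bits b)).
Proof.
move=> b b' /= eqD; apply/ffunP=> j.
have : (j.+2, j.+3, bit_x n (bits b) j.+2, bit_y n (bits b) j.+3)
    \in bit_diagram n (bits b').
  by rewrite -eqD; apply/mem_path_diagram; exists j.+2; rewrite //= !ltnS.
case/mem_path_diagram=> i _ /(congr1 (fun e : edge => (e.1.1.1, e.1.2))) [<-].
rewrite /bit_x /= !ltnS ltn_ord !bitsE.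
by case: (b j); case: (b' j).
Qed.

(** On an interior peg, [x] determines [y], so one bit per such peg records the diagram. *)
Lemma web_world_bits (n : nat) :
  web_world n = [fset bit_diagram n (bits b) | b : {ffun 'I_n -> bool}].
Proof.
apply/fsetP=> D; apply/web_worldP/imfsetP => /=.
  case=> x [y [x1 yn xy ->]]; exists [ffun j : 'I_n => x j.+2 == 2] => //.
  set b := bits _.
  have xyP i : 1 < i < n.+2 -> x i = bit_x n b i /\ y i = bit_y n b i.
    move=> i_in; rewrite /bit_x /bit_y i_in.
    have lt_in : i.-2 < n by lia.
    rewrite /b (bitsE _ (Ordinal lt_in)) ffunE /=.
    have -> : i.-2.+2 = i by lia.
    have /fsetP E : [fset x i; y i] = [fset 1; 2] by apply: xy; lia.
    move: (E (x i)) (E (y i)) (E 1) (E 2); rewrite !inE !eqxx orbT /=.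
    by case: (x i) => [|[|[|?]]]; case: (y i) => [|[|[|?]]].
  apply: eq_in_imfset => i i_in; move: (i_in : i \in iota 1 n.+1).
  rewrite mem_iota add1n => {}i_in.
  congr (_, _, _, _).
    case: (ltnP 1 i) => i1; first by have [] := xyP i ltac:(lia).
    have -> : i = 1 by lia.
    by rewrite x1 /bit_x.
  case: (ltnP i n.+1) => i1; first by have [] := xyP i.+1 ltac:(lia).
  have -> : i = n.+1 by lia.
  by rewrite yn /bit_y ltnn andbF.
case=> b _ ->; exists (bit_x n (bits b)), (bit_y n (bits b)); split=> //.
- by rewrite /bit_y ltnn andbF.
- move=> i i_in; rewrite /bit_x /bit_y ltnS i_in.
  by case: (bits b _) => //; rewrite fsetUC.
Qed.

Lemma prod_ties (l : nat) (s : seq 'I_l) (n : nat) : size s = n.+1 ->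
  \prod_(j < n) (nth 0 (map val s) j == nth 0 (map val s) j.+1).+1 =
  tie_weight s.
Proof.
elim: s n => // a [|b s] IHs n [<-]; first by rewrite big_ord0.
by rewrite big_ord_recl (IHs (size s)).
Qed.

(** The conditions on different pegs are independent, so the count is a product: two choices of bit
    at a tie, one elsewhere. *)
Lemma card_compatible (n l : nat) (s : n.+1.-tuple 'I_l) :
  #|[set b : {ffun 'I_n -> bool} | compatible n (bits b) (map val s)]| =
  tie_weight s.
Proof.
rewrite -(prod_ties (size_tuple s)).
pose ok (j : 'I_n) (v : bool) := let s' := map val s in
  v == (nth 0 s' j < nth 0 s' j.+1) || ((nth 0 s' j == nth 0 s' j.+1) && v).
transitivity #|family ok|.
  apply: eq_card => b; rewrite inE; apply: eq_forallb => j.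
  by rewrite bitsE.
rewrite card_family foldrE big_map big_enum /=; apply: eq_bigr => j _.
rewrite /ok /=; set u := nth _ _ _; set v := nth _ _ _.
have -> : (u == v).+1 = \sum_(w : bool) (w == (u < v) || ((u == v) && w)).
  by rewrite big_bool; case: (ltngtP u v).
by rewrite -sum1_card big_mkcond; apply: eq_bigr => w _; rewrite -topredE /=; case: ifP.
Qed.

(** Double counting of pairs of a diagram and a colouring fixing it: exchanging the sums counts, for
    each surjective tuple, its compatible bit vectors. *)
Lemma sum_ncolourings_diag (n l : nat) :
  \sum_(D <- web_world n) ncolourings D D l = tie_sum n.+1 [set: 'I_l].
Proof.
rewrite web_world_bits big_imfset /=; last by move=> b b' _ _ /bit_diagram_inj.
rewrite big_enum /=.
under eq_bigr => b _ do rewrite ncolourings_bit_diagram -sum1_card big_mkcond.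
rewrite exchange_big /= /tie_sum [RHS]big_mkcond; apply: eq_bigr => s _.
rewrite -card_compatible -sum1_card; case: ifP => sT.
  rewrite [RHS]big_mkcond; apply: eq_bigr => b _.
  by rewrite !inE sT.
by rewrite big1 // => b _; rewrite !inE sT.
Qed.

Local Open Scope ring_scope.
Import GRing.Theory.

Theorem theorem7p5 (n : nat) (hn : (1 <= n)%N) :
  \tr (web_matrix (web_world n)) =
  \sum_(1 <= k < n.+2)
    ((k`!)%:R * ((stirling2 n.+2 k.+1)%:R - (stirling2 n.+1 k.+1)%:R))
      *: 'X^k :> {poly int}.
Proof.
(* All diagrams of W(n) have n + 1 edges, so the entries share one range of summation, which can
   then be exchanged with the sum over diagrams. *)
have entryE (D : diagram) : D \in web_world n ->
    web_entry D D = \sum_(1 <= l < n.+2) (ncolourings D D l)%:R *: 'X^l.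
  by rewrite web_world_bits => /imfsetP[b _ ->]; rewrite /web_entry card_bit_diagram.
rewrite /mxtrace; under eq_bigr do rewrite mxE.
rewrite -(big_enum_val (fun D => web_entry (val D) (val D))) /=.
rewrite -(big_seq_fsetE _ (web_world n) xpredT (fun D => web_entry D D)).
rewrite big_seq (eq_bigr _ entryE) -big_seq exchange_big /=.
apply: eq_bigr => k _; rewrite -scaler_suml -natr_sum sum_ncolourings_diag.
rewrite !stirling2E mulrBr -!natrM.
(* Cast to integers, the additive identity yields the difference of Stirling numbers. *)
have := tie_sumE n [set: 'I_k]; rewrite cardsT card_ord => <-.
by rewrite natrD addrK.
Qed.
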